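(* Let $\mathbb{V}^{m\times n}$ ($m\le n$) be the space of $m\times n$ real (or complex) matrices, let $\mathcal{N}\subseteq\mathbb{V}^{m\times n}$ be a nonempty open set, let $g:\mathbb{R}^m\to\mathbb{R}^m$ be absolutely symmetric on an open set $\hat{\sigma}_{\mathcal N}\subseteq\mathbb{R}^m$ containing $\sigma_{\mathcal N}=\{\sigma(X)\mid X\in\mathcal{N}\}$, and let $G:\mathcal{N}\to\mathbb{V}^{m\times n}$ be the spectral operator with respect to $g$. Let $\overline{X}\in\mathcal{N}$ have the singular value decomposition $\overline{X}=\overline{U}\,[\Sigma(\overline{X})\ \ 0]\,\overline{V}^{\mathsf T}$. Then $G$ is locally Lipschitz continuous near $\overline{X}$ if and only if $g$ is locally Lipschitz continuous near $\overline{\sigma}=\sigma(\overline{X})$.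
   Context: $\mathbb{V}^{m\times n}$ is regarded as a real Euclidean vector space with the Frobenius norm $\|\cdot\|$ (inner product $\mathrm{Re}\,\mathrm{tr}(X^{\mathsf T}Y)$, where $^{\mathsf T}$ means transpose in the real case and conjugate transpose in the complex case). For $X\in\mathbb{V}^{m\times n}$, $\sigma(X)=(\sigma_1(X),\ldots,\sigma_m(X))\in\mathbb{R}^m$ is the vector of singular values with $\sigma_1(X)\ge\cdots\ge\sigma_m(X)\ge 0$, $\Sigma(X)=\mathrm{Diag}(\sigma(X))$ is the $m\times m$ diagonal matrix with these entries, and $\mathbb{O}^{m,n}(X)$ is the set of all pairs $(U,V)$ of $m\times m$ and $n\times n$ orthogonal (unitary in the complex case) matrices with $X=U[\Sigma(X)\ \ 0]V^{\mathsf T}$; in the singular value decomposition of $\overline X$, $(\overline U,\overline V)\in\mathbb{O}^{m,n}(\overline X)$. Let $\pm\mathbb{P}^m$ be the set of $m\times m$ signed permutation matrices (exactly one nonzero entry, equal to $\pm1$, in each row and each column). The mapping $g:\mathbb{R}^m\to\mathbb{R}^m$ is absolutely symmetric (mixed symmetric with respect to $\pm\mathbb{P}^m$) on a set $\mathcal{D}\subseteq\mathbb{R}^m$ if $g(Qx)=Qg(x)$ for all $Q\in\pm\mathbb{P}^m$ and all $x\in\mathcal{D}$. The spectral operator $G:\mathcal{N}\to\mathbb{V}^{m\times n}$ with respect to $g$ is defined by $G(X)=U[\mathrm{Diag}(g(\sigma(X)))\ \ 0]V^{\mathsf T}$, $X\in\mathcal{N}$, where $(U,V)\in\mathbb{O}^{m,n}(X)$;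 by the absolute symmetry of $g$ this does not depend on the choice of $(U,V)$. A map is locally Lipschitz continuous near a point if it is Lipschitz continuous on some open neighborhood of that point. *)

(* Defs.v *)
From HB Require Import structures.
From mathcomp Require Import all_boot all_order all_algebra.
From mathcomp Require Import complex.
From mathcomp Require Import all_classical all_reals all_analysis.
Set Implicit Arguments.
Unset Strict Implicit.
Unset Printing Implicit Defensive.
Import Order.TTheory GRing.Theory Num.Theory.
Import numFieldNormedType.Exports.
Local Open Scope classical_set_scope.
Local Open Scope ring_scope.

Variant ground := ground_real | ground_complex.

(* Being a numFieldType, [ground_field R k] carries the topology of its norm, so
   ['M[ground_field R k]_(m, n)] carries the product topology, which is the
   topology of the Frobenius norm. *)
Definition ground_field (R : realType) (k : ground) : numFieldType :=
  match k with
  | ground_real => R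
  | ground_complex => complex R
  end.

Definition ofreal (R : realType) (k : ground) : R -> ground_field R k :=
  match k return R -> ground_field R k with
  | ground_real => fun x => x
  | ground_complex => fun x => real_complex R x
  end.

Definition sconj (R : realType) (k : ground) : ground_field R k -> ground_field R k :=
  match k return ground_field R k -> ground_field R k with
  | ground_real => fun x => x
  | ground_complex => fun x => conjc x
  end.

Definition sRe (R : realType) (k : ground) : ground_field R k -> R :=
  match k return ground_field R k -> R with
  | ground_real => fun x => x
  | ground_complex => fun x => complex.Re x
  end.

Section SpectralOperators.
Variables (R : realType) (k : ground).
Local Notation K := (ground_field R k).

Definition adjoint (m n : nat) (X : 'M[K]_(m, n)) : 'M[K]_(n, m) :=
  map_mx (@sconj R k) X^T.

Definition unitary (n : nat) (U : 'M[K]_n) : Prop := adjoint U *m U = 1%:M.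

Definition frob_inner (m n : nat) (X Y : 'M[K]_(m, n)) : R :=
  sRe (\tr (adjoint X *m Y)).

Definition frob_norm (m n : nat) (X : 'M[K]_(m, n)) : R :=
  Num.sqrt (frob_inner X X).

(* [s] lists in nonincreasing order the square roots of the eigenvalues of
   X X^T, counted with multiplicity. *)
Definition is_singular_values (m n : nat) (X : 'M[K]_(m, n)) (s : 'cV[R]_m) :
    Prop :=
  [/\ forall i j : 'I_m, (i <= j)%N -> s j 0 <= s i 0,
      forall i, 0 <= s i 0 &
      char_poly (X *m adjoint X)
        = \prod_(i < m) ('X - (ofreal k (s i 0 ^+ 2))%:P)].

(* The default value 0 is never used: singular values exist and are unique. *)
Definition sigma (m n : nat) (X : 'M[K]_(m, n)) : 'cV[R]_m :=
  xget 0 [set s | is_singular_values X s].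

(* The m x n matrix [Diag(x) 0]; meant for m <= n. *)
Definition diag0 (m n : nat) (x : 'cV[R]_m) : 'M[K]_(m, n) :=
  \matrix_(i < m, j < n) (if i == j :> nat then ofreal k (x i 0) else 0).

(* The set O^{m,n}(X). *)
Definition svd_pairs (m n : nat) (X : 'M[K]_(m, n)) :
    set ('M[K]_m * 'M[K]_n) :=
  [set UV | [/\ unitary UV.1, unitary UV.2 &
                X = UV.1 *m diag0 n (sigma X) *m adjoint UV.2]].

(* [G] is total, but only its values on N are specified.  Some pair (U, V) is
   required, not every one: independence of the choice is not assumed. *)
Definition is_spectral_operator (m n : nat) (N : set 'M[K]_(m, n))
    (g : 'cV[R]_m -> 'cV[R]_m) (G : 'M[K]_(m, n) -> 'M[K]_(m, n)) : Prop :=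
  forall X, N X -> exists2 UV, svd_pairs X UV &
    G X = UV.1 *m diag0 n (g (sigma X)) *m adjoint UV.2.

(* [D] is the domain of [F].  With [ground_real] and n = 1 the Frobenius norm is
   the Euclidean norm of R^m. *)
Definition locally_lipschitz_near (m n : nat) (D : set 'M[K]_(m, n))
    (F : 'M[K]_(m, n) -> 'M[K]_(m, n)) (x : 'M[K]_(m, n)) : Prop :=
  exists W : set 'M[K]_(m, n), [/\ open W, W x, W `<=` D &
    exists L : R, forall y z, W y -> W z ->
      frob_norm (F y - F z) <= L * frob_norm (y - z)].

End SpectralOperators.

Definition signed_perm_mx (R : realType) (m : nat) (Q : 'M[R]_m) : Prop :=
  [/\ forall i j, [\/ Q i j = 0, Q i j = 1 | Q i j = - 1],
      forall i, exists! j, Q i j <> 0 &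
      forall j, exists! i, Q i j <> 0].

Definition absolutely_symmetric (R : realType) (m : nat) (D : set 'cV[R]_m)
    (g : 'cV[R]_m -> 'cV[R]_m) : Prop :=
  forall Q : 'M[R]_m, signed_perm_mx Q ->
    forall x, D x -> g (Q *m x) = Q *m g x.

(* Main.v *)
(* If X = U1 [Diag(a) 0] V1^* and Y = U2 [Diag(b) 0] V2^*, then for fixed unitary
   factors there are nonnegative weights wm, wp, with wm + wp doubly stochastic,
   such that for all a and b
     |X - Y|^2 = sum_ij wm_ij (a_j - b_i)^2 + wp_ij (a_j + b_i)^2.
   With sorted nonnegative a and b this gives the Lipschitz continuity of the
   singular values.  The same weights compute |G X - G Y|^2 from g a and g b.
   A locally Lipschitz absolutely symmetric g satisfies
     |g_j(a) -+ g_i(a)| <= C |a_j -+ a_i|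
   near sigma(Xbar): compare g at a and at its image under a signed
   transposition when the two points are close, and use the boundedness of g
   otherwise.  Hence g Lipschitz implies G Lipschitz, term by term.  Conversely,
   y |-> Ubar [Diag(y) 0] Vbar^* is an isometry, and near sigma(Xbar) it
   intertwines g with G. *)

Require Import Defs.
From HB Require Import structures.
From mathcomp Require Import all_boot all_order all_algebra.
From mathcomp Require Import complex.
From mathcomp Require Import all_classical all_reals all_analysis.
From mathcomp Require Import perm ring lra.
Set Implicit Arguments.
Unset Strict Implicit.
Unset Printing Implicit Defensive.
Import Order.TTheory GRing.Theory Num.Theory.
Import numFieldNormedType.Exports.
Local Open Scope classical_set_scope.
Local Open Scope ring_scope.

(** * Scalars of the two ground fields, treated uniformly *)

Section GroundField.
Variables (R : realType) (k : ground).
Local Notation K := (ground_field R k).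

Lemma sconj_is_zmod_morphism : zmod_morphism (@sconj R k).
Proof. by case: k => //= x y; rewrite rmorphB. Qed.

Lemma sconj_is_monoid_morphism : monoid_morphism (@sconj R k).
Proof.
by case: k; split=> // [|x y];
  [apply: (rmorph1 (@conjc R)) | apply: (rmorphM (@conjc R))].
Qed.

HB.instance Definition _ :=
  GRing.isZmodMorphism.Build K K (@sconj R k) sconj_is_zmod_morphism.
HB.instance Definition _ :=
  GRing.isMonoidMorphism.Build K K (@sconj R k) sconj_is_monoid_morphism.

Lemma ofreal_is_zmod_morphism : zmod_morphism (@ofreal R k).
Proof. by case: k => //= x y; rewrite rmorphB. Qed.

Lemma ofreal_is_monoid_morphism : monoid_morphism (@ofreal R k).
Proof.
by case: k; split=> // x y; apply: (rmorphM (real_complex R)).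
Qed.

HB.instance Definition _ :=
  GRing.isZmodMorphism.Build R K (@ofreal R k) ofreal_is_zmod_morphism.
HB.instance Definition _ :=
  GRing.isMonoidMorphism.Build R K (@ofreal R k) ofreal_is_monoid_morphism.

Lemma sRe_is_zmod_morphism : zmod_morphism (@sRe R k).
Proof. by case: k => //= -[a b] [c d]. Qed.

HB.instance Definition _ :=
  GRing.isZmodMorphism.Build K R (@sRe R k) sRe_is_zmod_morphism.

Lemma sconjK : involutive (@sconj R k).
Proof. by case: k => //= -[a b]; rewrite /= opprK. Qed.

Lemma sconj_ofreal (x : R) : sconj (ofreal k x) = ofreal k x.
Proof. by case: k => //=; rewrite oppr0. Qed.

Lemma ofrealK : cancel (@ofreal R k) (@sRe R k).
Proof. by case: k. Qed.

(** The squared modulus, kept in [R] because the norm on [K] takes its values in [K]. *)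
Definition sqnorm (x : K) : R := sRe (sconj x * x).

Lemma sqnorm_ge0 x : 0 <= sqnorm x.
Proof.
rewrite /sqnorm; case: k x => [x|[a b]] /=; first by rewrite -expr2 sqr_ge0.
by rewrite mulNr opprK addr_ge0 // -expr2 sqr_ge0.
Qed.

Lemma sqnorm0 : sqnorm 0 = 0.
Proof. by rewrite /sqnorm mulr0 raddf0. Qed.

Lemma sqnorm_eq0 x : sqnorm x = 0 -> x = 0.
Proof.
rewrite /sqnorm; case: k x => [x|[a b]] /= /eqP.
  by rewrite mulf_eq0 orbb => /eqP.
rewrite mulNr opprK paddr_eq0 -?expr2 ?sqr_ge0 // !sqrf_eq0.
by case/andP=> /eqP-> /eqP->.
Qed.

Lemma sqnorm_conj x : sqnorm (sconj x) = sqnorm x.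
Proof. by rewrite /sqnorm sconjK mulrC. Qed.

Lemma sqnorm_ofreal (x : R) : sqnorm (ofreal k x) = x ^+ 2.
Proof. by rewrite /sqnorm sconj_ofreal -rmorphM ofrealK expr2. Qed.

Lemma normr_ofreal (x : K) : `|x| = ofreal k (Num.sqrt (sqnorm x)).
Proof.
rewrite /sqnorm; case: k x => [x|[a b]] /=; first by rewrite -expr2 sqrtr_sqr.
by rewrite mulNr opprK -!expr2.
Qed.

Lemma ofreal_lt (x y : R) : (ofreal k x < ofreal k y) = (x < y).
Proof. by case: k => //=; rewrite ltcR. Qed.

(** Radii of balls are elements of [K]; a positive one equals its own modulus and so comes from
    [R]. *)
Lemma gt0_ofreal (x : K) : 0 < x -> exists2 e : R, 0 < e & x = ofreal k e.
Proof.
move=> x0; exists (Num.sqrt (sqnorm x)); last by rewrite -normr_ofreal gtr0_norm.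
by rewrite -ofreal_lt rmorph0 -normr_ofreal normr_gt0 gt_eqF.
Qed.

(* The last summand vanishes when summed over the entries of two unitary
   matrices, since both [sqnorm x] and [sqnorm y] are then doubly stochastic. *)
Lemma sqnorm_polarization (x y : K) (a b : R) :
  sqnorm (x * ofreal k a - ofreal k b * y) =
  sqnorm (x + y) / 4 * (a - b) ^+ 2 + sqnorm (x - y) / 4 * (a + b) ^+ 2
  + (sqnorm x - sqnorm y) / 2 * (a ^+ 2 - b ^+ 2).
Proof.
rewrite /sqnorm; case: k x y => [x y|[x1 x2] [y1 y2]] /=; by field.
Qed.

(** With entries of two unitary matrices inserted, the left-hand terms become the weights, and the
    right-hand side shows that their sum is doubly stochastic. *)
Lemma sqnorm_parallelogram (x y : K) :
  sqnorm (x + y) / 4 + sqnorm (x - y) / 4 = (sqnorm x + sqnorm y) / 2.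
Proof.
rewrite /sqnorm; case: k x y => [x y|[x1 x2] [y1 y2]] /=; by field.
Qed.

End GroundField.

(** * Frobenius norm and unitary matrices *)

Section Frobenius.
Variables (R : realType) (k : ground).
Local Notation K := (ground_field R k).

Lemma adjointM m n p (A : 'M[K]_(m, n)) (B : 'M[K]_(n, p)) :
  adjoint (A *m B) = adjoint B *m adjoint A.
Proof. by rewrite /adjoint trmx_mul map_mxM. Qed.

Lemma adjointK m n (A : 'M[K]_(m, n)) : adjoint (adjoint A) = A.
Proof. by apply/matrixP => i j; rewrite !mxE sconjK. Qed.

Lemma unitaryC n (U : 'M[K]_n) : unitary U -> U *m adjoint U = 1%:M.
Proof. exact: mulmx1C. Qed.

Lemma unitary_adjoint n (U : 'M[K]_n) : unitary U -> unitary (adjoint U).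
Proof. by move=> /unitaryC; rewrite /unitary adjointK. Qed.

Lemma unitaryM n (U V : 'M[K]_n) : unitary U -> unitary V -> unitary (U *m V).
Proof.
move=> hU hV; rewrite /unitary adjointM mulmxA -(mulmxA _ _ U) hU mulmx1.
exact: hV.
Qed.

Lemma frob_normE m n (X : 'M[K]_(m, n)) :
  frob_norm X ^+ 2 = \sum_i \sum_j sqnorm (X i j).
Proof.
have E : frob_inner X X = \sum_i \sum_j sqnorm (X i j).
  rewrite /frob_inner /mxtrace raddf_sum exchange_big; apply: eq_bigr => j _.
  by rewrite mxE raddf_sum; apply: eq_bigr => i _; rewrite !mxE.
rewrite /frob_norm sqr_sqrtr E //.
by apply: sumr_ge0 => i _; apply: sumr_ge0 => j _; apply: sqnorm_ge0.
Qed.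

Lemma frob_norm_ge0 m n (X : 'M[K]_(m, n)) : 0 <= frob_norm X.
Proof. exact: sqrtr_ge0. Qed.

Lemma frob_norm_eq0 m n (X : 'M[K]_(m, n)) : frob_norm X ^+ 2 = 0 -> X = 0.
Proof.
rewrite frob_normE => X0; apply/matrixP => i j; rewrite mxE; apply: sqnorm_eq0.
have h r : 0 <= \sum_c sqnorm (X r c).
  by apply: sumr_ge0 => c _; apply: sqnorm_ge0.
have /psumr_eq0P : \sum_c sqnorm (X i c) = 0.
  by apply: (psumr_eq0P _ X0).
by apply=> // c _; apply: sqnorm_ge0.
Qed.

Lemma frob_norm_unitary m n (U : 'M[K]_m) (V : 'M[K]_n) (X : 'M[K]_(m, n)) :
  unitary U -> unitary V -> frob_norm (U *m X *m adjoint V) = frob_norm X.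
Proof.
move=> hU hV; rewrite /frob_norm /frob_inner !adjointM adjointK.
rewrite -!mulmxA mxtrace_mulC !mulmxA -(mulmxA _ (adjoint U)) hU mulmx1.
by rewrite -!mulmxA hV mulmx1.
Qed.

Lemma entry_le_frob_norm m n (X : 'M[K]_(m, n)) i j :
  sqnorm (X i j) <= frob_norm X ^+ 2.
Proof.
rewrite frob_normE (bigD1 i) //= (bigD1 j) //= -addrA lerDl.
by rewrite addr_ge0 ?sumr_ge0 // => *; rewrite ?sumr_ge0 // => *; apply: sqnorm_ge0.
Qed.

Lemma frob_norm_diag0 m n (x : 'cV[R]_m) : (m <= n)%N ->
  frob_norm (diag0 k n x : 'M[K]_(m, n)) ^+ 2 = \sum_i x i 0 ^+ 2.
Proof.
move=> hmn; rewrite frob_normE; apply: eq_bigr => i _.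
rewrite (bigD1 (widen_ord hmn i)) //= big1 => [|j nij].
  by rewrite addr0 mxE eqxx sqnorm_ofreal.
rewrite mxE; case: ifP => [/eqP e|_]; last exact: sqnorm0.
by case/eqP: nij; apply: val_inj.
Qed.

Lemma diag0B m n (x y : 'cV[R]_m) :
  diag0 k n (x - y) = diag0 k n x - diag0 k n y :> 'M[K]_(m, n).
Proof.
by apply/matrixP => i j; rewrite !mxE; case: eqP; rewrite ?subr0 // rmorphB.
Qed.

Lemma sum_sqnorm_row n (U : 'M[K]_n) i :
  unitary U -> \sum_j sqnorm (U i j) = 1.
Proof.
move=> /unitaryC /matrixP /(_ i i); rewrite !mxE eqxx => /(congr1 (@sRe R k)).
rewrite -[in X in _ = X](rmorph1 (@ofreal R k)) ofrealK raddf_sum => <-.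
by apply: eq_bigr => j _; rewrite !mxE /sqnorm mulrC.
Qed.

Lemma sum_sqnorm_col n (U : 'M[K]_n) j :
  unitary U -> \sum_i sqnorm (U i j) = 1.
Proof.
move=> /unitary_adjoint /(sum_sqnorm_row j) <-.
by apply: eq_bigr => i _; rewrite !mxE sqnorm_conj.
Qed.

End Frobenius.

Lemma frob_norm_col (R : realType) m (x : 'cV[R]_m) :
  @frob_norm R ground_real m 1 x ^+ 2 = \sum_i x i 0 ^+ 2.
Proof. by rewrite frob_normE; apply: eq_bigr => i _; rewrite big_ord1 expr2. Qed.

(** * Doubly stochastic weights and a Weyl-type bound *)

Definition doubly_stochastic (R : realType) n (w : 'I_n -> 'I_n -> R) : Prop :=
  [/\ forall i j, 0 <= w i j, forall i, \sum_j w i j = 1 &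
      forall j, \sum_i w i j = 1].

Section Weyl.
Variables (R : realType) (n : nat).
Implicit Types (w : 'I_n -> 'I_n -> R) (x y : 'I_n -> R).

Lemma doubly_stochastic_tr w :
  doubly_stochastic w -> doubly_stochastic (fun i j => w j i).
Proof. by case=> w0 wr wc; split. Qed.

(** The rows up to [c] carry total mass [c + 1], and the [c] columns before [c] can absorb at most
    [c] of it. *)
Lemma doubly_stochastic_corner w (c : 'I_n) : doubly_stochastic w ->
  1 <= \sum_(i < n | (i <= c)%N) \sum_(j < n | (c <= j)%N) w i j.
Proof.
case=> w0 wr wc.
have rows : \sum_(i < n | (i <= c)%N) \sum_j w i j = c.+1%:R.
  by rewrite (eq_bigr (fun=> 1)) // (big_ord_narrow (ltn_ord c)) sumr_const card_ord.
have cols : \sum_(i < n | (i <= c)%N) \sum_(j < n | ~~ (c <= j)%N) w i j <= c%:R.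
  rewrite exchange_big /=.
  apply: (@le_trans _ _ (\sum_(j < n | ~~ (c <= j)%N) 1)).
    apply: ler_sum => j _; rewrite -(wc j) [leRHS](bigID (fun i : 'I_n => i <= c)%N).
    by rewrite lerDl; apply: sumr_ge0.
  under eq_bigl do rewrite -ltnNge.
  by rewrite (big_ord_narrow (ltnW (ltn_ord c))) sumr_const card_ord.
have : \sum_(i < n | (i <= c)%N) \sum_j w i j =
   \sum_(i < n | (i <= c)%N) \sum_(j < n | (c <= j)%N) w i j +
   \sum_(i < n | (i <= c)%N) \sum_(j < n | ~~ (c <= j)%N) w i j.
  rewrite -big_split; apply: eq_bigr => i _.
  exact: (bigID (fun j : 'I_n => c <= j)%N).
rewrite rows -natr1; lra.
Qed.

(** On the block [i <= c <= j] monotonicity gives [x i - y j >= x c - y c >= 0], and this block has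
    mass at least one. *)
Lemma doubly_stochastic_weyl_le w x y c : doubly_stochastic w ->
  (forall i j : 'I_n, (i <= j)%N -> x j <= x i) ->
  (forall i j : 'I_n, (i <= j)%N -> y j <= y i) -> y c <= x c ->
  (x c - y c) ^+ 2 <= \sum_i \sum_j w i j * (y j - x i) ^+ 2.
Proof.
move=> hw sx sy yx; have [w0 _ _] := hw.
have t0 i j : 0 <= w i j * (y j - x i) ^+ 2 by rewrite mulr_ge0 ?sqr_ge0.
rewrite -[leLHS]mul1r.
apply: (le_trans (ler_wpM2r (sqr_ge0 _) (doubly_stochastic_corner c hw))).
rewrite [leRHS](bigID (fun i : 'I_n => i <= c)%N) /=.
rewrite mulr_suml -[leLHS]addr0; apply: lerD; last first.
  by apply: sumr_ge0 => i _; apply: sumr_ge0.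
apply: ler_sum => i ic; rewrite [leRHS](bigID (fun j : 'I_n => c <= j)%N) /=.
rewrite mulr_suml -[leLHS]addr0; apply: lerD; last exact: sumr_ge0.
apply: ler_sum => j cj; apply: ler_wpM2l => //.
have := sx _ _ ic; have := sy _ _ cj.
rewrite -(sqrrN (y j - x i)) opprB => *.
by rewrite ler_sqr ?nnegrE; lra.
Qed.

Lemma doubly_stochastic_weyl w x y c : doubly_stochastic w ->
  (forall i j : 'I_n, (i <= j)%N -> x j <= x i) ->
  (forall i j : 'I_n, (i <= j)%N -> y j <= y i) ->
  (x c - y c) ^+ 2 <= \sum_i \sum_j w i j * (y j - x i) ^+ 2.
Proof.
move=> hw sx sy; have [yx|xy] := leP (y c) (x c).
  exact: doubly_stochastic_weyl_le.
(* The opposite order follows by exchanging [x] with [y] and transposing [w]. *)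
rewrite -sqrrN opprB exchange_big /=.
apply: le_trans (doubly_stochastic_weyl_le (doubly_stochastic_tr hw) sy sx _) _.
  exact: ltW.
by apply: ler_sum => i _; apply: ler_sum => j _; rewrite -[in leRHS]sqrrN opprB.
Qed.

End Weyl.

(* [pair_dist wm wp a b] is the squared Frobenius distance between
   [U1 Diag(a) V1^*] and [U2 Diag(b) V2^*]; the weights record the
   entrywise sums and differences of [U2^* U1] and [V2^* V1]. *)
Definition pair_dist (R : realType) n (wm wp : 'I_n -> 'I_n -> R)
    (a b : 'cV[R]_n) : R :=
  \sum_i \sum_j (wm i j * (a j 0 - b i 0) ^+ 2 + wp i j * (a j 0 + b i 0) ^+ 2).

(** The appended zeros let a rectangular decomposition be treated as a square one. *)
Definition pad (R : realType) (m p : nat) (a : 'cV[R]_m) : 'cV[R]_(m + p) :=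
  col_mx a 0.

(** * Distance between two singular value decompositions *)

Section SvdDistance.
Variables (R : realType) (k : ground).
Local Notation K := (ground_field R k).

Lemma sum_zero_marginals n (w : 'I_n -> 'I_n -> R) (a b : 'cV[R]_n) :
  (forall i, \sum_j w i j = 0) -> (forall j, \sum_i w i j = 0) ->
  \sum_i \sum_j w i j * (a j 0 ^+ 2 - b i 0 ^+ 2) = 0.
Proof.
move=> wr wc.
transitivity (\sum_i \sum_j w i j * a j 0 ^+ 2 - \sum_i \sum_j w i j * b i 0 ^+ 2).
  rewrite -sumrB; apply: eq_bigr => i _; rewrite -sumrB.
  by apply: eq_bigr => j _; rewrite mulrBr.
rewrite exchange_big /= !big1 ?subr0 // => i _; rewrite -mulr_suml.
  by rewrite wr mul0r.
by rewrite wc mul0r.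
Qed.

(** Unitary invariance reduces the difference to [A Diag(a) - Diag(b) B], whose entries
    [A i j * a j - b i * B i j] have the form treated by [sqnorm_polarization]. *)
Lemma svd_dist_square n (U1 U2 V1 V2 : 'M[K]_n) :
  unitary U1 -> unitary U2 -> unitary V1 -> unitary V2 ->
  exists wm wp : 'I_n -> 'I_n -> R,
  [/\ forall i j, 0 <= wm i j, forall i j, 0 <= wp i j,
      doubly_stochastic (fun i j => wm i j + wp i j) &
      forall a b : 'cV[R]_n,
        frob_norm (U1 *m diag0 k n a *m adjoint V1
                   - U2 *m diag0 k n b *m adjoint V2) ^+ 2
        = pair_dist wm wp a b].
Proof.
move=> hU1 hU2 hV1 hV2.
pose A := adjoint U2 *m U1; pose B := adjoint V2 *m V1.
have hA : unitary A by apply: unitaryM => //; apply: unitary_adjoint.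
have hB : unitary B by apply: unitaryM => //; apply: unitary_adjoint.
exists (fun i j => sqnorm (A i j + B i j) / 4).
exists (fun i j => sqnorm (A i j - B i j) / 4).
have wE i j := sqnorm_parallelogram (A i j) (B i j).
have w0 (z : K) : 0 <= sqnorm z / 4 by rewrite divr_ge0 ?sqnorm_ge0.
split=> //; first split.
- by move=> i j; rewrite addr_ge0.
- move=> i; under eq_bigr do rewrite wE.
  by rewrite -mulr_suml big_split !sum_sqnorm_row //=; lra.
- move=> j; under eq_bigr do rewrite wE.
  by rewrite -mulr_suml big_split !sum_sqnorm_col //=; lra.
move=> a b.
have -> : U1 *m diag0 k n a *m adjoint V1 - U2 *m diag0 k n b *m adjoint V2
    = U2 *m (A *m diag0 k n a - diag0 k n b *m B) *m adjoint V1.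
  rewrite mulmxBr mulmxBl; congr (_ - _).
    by rewrite /A !mulmxA unitaryC // mul1mx.
  by rewrite /B -!mulmxA unitaryC // mulmx1.
rewrite frob_norm_unitary // frob_normE /pair_dist.
(* Coefficient of the last polarization term; rows and columns of [A] and [B] have unit length, so
   both marginals of [d] vanish. *)
pose d i j : R := (sqnorm (A i j) - sqnorm (B i j)) / 2.
have d0 : \sum_i \sum_j d i j * (a j 0 ^+ 2 - b i 0 ^+ 2) = 0.
  apply: sum_zero_marginals => [i|j]; rewrite /d -mulr_suml sumrB.
    by rewrite !sum_sqnorm_row // subrr mul0r.
  by rewrite !sum_sqnorm_col // subrr mul0r.
rewrite -[RHS]addr0 -[X in _ = _ + X]d0 -big_split /=; apply: eq_bigr => i _.
rewrite -big_split; apply: eq_bigr => j _ /=.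
rewrite -sqnorm_polarization; congr sqnorm; rewrite mxE; congr (_ + _).
  rewrite mxE (bigD1 j) //= big1 => [|l lj];
    first by rewrite addr0 [X in _ * X]mxE eqxx.
  by rewrite [X in _ * X]mxE (inj_eq val_inj) ifN ?mulr0.
rewrite mxE; congr (- _).
rewrite mxE (bigD1 i) //= big1 => [|l li]; first by rewrite addr0 [X in X * _]mxE eqxx.
by rewrite [X in X * _]mxE (inj_eq val_inj) ifN ?mul0r // eq_sym.
Qed.

(** Bordering [U1] and [U2] with an identity block makes everything square; the products only gain
    zero rows, which leave the norm unchanged. *)
Lemma svd_dist m p (U1 U2 : 'M[K]_m) (V1 V2 : 'M[K]_(m + p)) :
  unitary U1 -> unitary U2 -> unitary V1 -> unitary V2 ->
  exists wm wp : 'I_(m + p) -> 'I_(m + p) -> R,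
  [/\ forall i j, 0 <= wm i j, forall i j, 0 <= wp i j,
      doubly_stochastic (fun i j => wm i j + wp i j) &
      forall a b : 'cV[R]_m,
        frob_norm (U1 *m diag0 k (m + p) a *m adjoint V1
                   - U2 *m diag0 k (m + p) b *m adjoint V2) ^+ 2
        = pair_dist wm wp (pad p a) (pad p b)].
Proof.
move=> hU1 hU2 hV1 hV2.
pose ext (U : 'M[K]_m) : 'M[K]_(m + p) := block_mx U 0 0 1%:M.
have adjE (U : 'M[K]_m) : adjoint (ext U) = block_mx (adjoint U) 0 0 1%:M.
  by rewrite /adjoint tr_block_mx map_block_mx !trmx0 !map_mx0 trmx1 map_mx1.
have hext U : unitary U -> unitary (ext U).
  move=> hU; rewrite /unitary adjE mulmx_block !mul0mx !mulmx0 mulmx1 !addr0 add0r.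
  by rewrite hU -scalar_mx_block.
have [wm [wp [wm0 wp0 ww wE]]] :=
  svd_dist_square (hext _ hU1) (hext _ hU2) hV1 hV2.
exists wm, wp; split=> // a b; rewrite -wE.
have padE c : diag0 k (m + p) (pad p c) = col_mx (diag0 k (m + p) c) 0.
  apply/matrixP => i j; rewrite mxE /pad.
  case: (split_ordP i) => l ->; rewrite ?col_mxEu ?col_mxEd mxE ?mxE //.
  by rewrite rmorph0 if_same.
have mulE (U : 'M[K]_m) (V : 'M[K]_(m + p)) c :
    ext U *m diag0 k (m + p) (pad p c) *m adjoint V
    = col_mx (U *m diag0 k (m + p) c *m adjoint V) 0.
  by rewrite padE mul_block_col !mul0mx mulmx0 !addr0 mul_col_mx mul0mx.
rewrite !mulE opp_col_mx add_col_mx !frob_normE oppr0 addr0 [RHS]big_split_ord /=.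
rewrite -[LHS]addr0; congr (_ + _).
  by apply: eq_bigr => i _; apply: eq_bigr => j _; rewrite col_mxEu.
rewrite big1 // => i _; rewrite big1 // => j _.
by rewrite col_mxEd mxE sqnorm0.
Qed.

End SvdDistance.

(** * Signed permutations acting on vectors and on padded vectors *)

Section SignedPermutations.
Variables (R : realType) (m : nat).
Implicit Types (e : 'I_m -> bool) (s : {perm 'I_m}) (x : 'cV[R]_m).

(** Action of the signed permutation matrix whose row [i] has its nonzero entry [(-1) ^+ e i] in
    column [s i]. *)
Definition sperm e s x : 'cV[R]_m := \col_i ((-1) ^+ e i * x (s i) 0).

Lemma absolutely_symmetric_sperm (D : set 'cV[R]_m) g e s x :
  absolutely_symmetric D g -> D x -> g (sperm e s x) = sperm e s (g x).
Proof.
move=> gD Dx; pose Q : 'M[R]_m := \matrix_(i, j) ((-1) ^+ e i *+ (s i == j)).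
have QE y : sperm e s y = Q *m y.
  apply/matrixP => i j; rewrite ord1 !mxE (bigD1 (s i)) //= big1.
    by rewrite addr0 mxE eqxx.
  by move=> l /negPf li; rewrite mxE eq_sym li mulr0n mul0r.
have Q0 i j : Q i j <> 0 <-> s i = j.
  rewrite mxE; split=> [|<-]; last by rewrite eqxx; apply/eqP; rewrite signr_eq0.
  by case: eqP => // _; rewrite mulr0n.
rewrite !QE; apply: gD => //; split.
- move=> i j; rewrite mxE; case: eqP => _; last by constructor.
  by case: (e i); rewrite ?expr1 ?expr0 mulr1n; constructor.
- by move=> i; exists (s i); split=> [|j /Q0//]; apply/Q0.
- move=> j; exists (s^-1 j)%g; split=> [|i /Q0 <-]; last exact: permK.
  by apply/Q0; exact: permKV.
Qed.

Lemma sum_sperm_le e s x :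
  \sum_i (sperm e s x i 0 - x i 0) ^+ 2 <= 4 * \sum_i x i 0 ^+ 2.
Proof.
have permE : \sum_i x (s i) 0 ^+ 2 = \sum_i x i 0 ^+ 2.
  by rewrite [RHS](reindex_inj (@perm_inj _ s)).
have -> : 4 * \sum_i x i 0 ^+ 2 = \sum_i (2 * x (s i) 0 ^+ 2 + 2 * x i 0 ^+ 2).
  by rewrite big_split -!mulr_sumr permE /=; ring.
apply: ler_sum => i _; rewrite mxE.
have -> : x (s i) 0 ^+ 2 = ((-1) ^+ e i * x (s i) 0) ^+ 2.
  by rewrite exprMn sqrr_sign mul1r.
by move: (_ ^+ e i * _) (x i 0) => u v; have := sqr_ge0 (u + v); nra.
Qed.

(** Transposing [i] and [j], with both signs flipped when [b] holds, moves two coordinates by the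
    same amount, whence [c = 2]; for [i = j] at most one coordinate moves and [c = 1]. *)
Lemma sperm_pair (b : bool) (i j : 'I_m) : exists e s c, 0 < c /\
  forall x, \sum_l (sperm e s x l 0 - x l 0) ^+ 2
            = c * ((-1) ^+ b * x j 0 - x i 0) ^+ 2.
Proof.
exists (fun l => b && ((l == i) || (l == j))), (tperm i j).
exists (if i == j then 1 else 2%:R); split=> [|x]; first by case: eqP.
have rest l : l != i -> l != j ->
    (sperm (fun l => b && ((l == i) || (l == j))) (tperm i j) x l 0 - x l 0) ^+ 2 = 0.
  move=> /[dup] li /negPf li' /[dup] lj /negPf lj'.
  by rewrite mxE li' lj' andbF tpermD 1?eq_sym // mul1r subrr expr0n.
rewrite (bigD1 i) //=; have [ij|ij] := eqVneq i j.
  subst j; rewrite big1 => [|l li]; last by rewrite rest.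
  by rewrite addr0 mul1r mxE eqxx andbT tpermL.
rewrite (bigD1 j) //= 1?eq_sym // big1 => [|l /andP[li lj]]; last by rewrite rest.
rewrite !mxE !eqxx orbT !andbT tpermL tpermR addr0.
by case: b {rest}; rewrite ?expr0 ?expr1; ring.
Qed.

Lemma sperm_pad p (b : bool) (i j : 'I_(m + p)) : exists e s c, 0 < c /\
  forall x, \sum_l (sperm e s x l 0 - x l 0) ^+ 2
            = c * ((-1) ^+ b * pad p x j 0 - pad p x i 0) ^+ 2.
Proof.
case: (split_ordP i) => i' ->; case: (split_ordP j) => j' ->.
- have [e [s [c [c0 cE]]]] := sperm_pair b i' j'.
  by exists e, s, c; split=> // x; rewrite cE /pad !col_mxEu.
(* The other entry is a padding zero, so a sign flip of coordinate [i'] serves: it moves by twice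
   its value, hence the factor 4. *)
- have [e [s [c [c0 cE]]]] := sperm_pair true i' i'.
  exists e, s, (4 * c); split=> [|x]; first by rewrite mulr_gt0.
  by rewrite cE /pad col_mxEu col_mxEd mxE; ring.
- have [e [s [c [c0 cE]]]] := sperm_pair true j' j'.
  exists e, s, (4 * c); split=> [|x]; first by rewrite mulr_gt0.
  by rewrite cE /pad col_mxEu col_mxEd mxE; case: b; rewrite ?expr0 ?expr1; ring.
- exists (fun=> false), 1%g, 1; split=> // x.
  rewrite /pad !col_mxEd !mxE mulr0 subr0 expr0n mulr0 big1 // => l _.
  by rewrite !mxE perm1 mul1r subrr expr0n.
Qed.

Lemma pad_sperm p e s (i : 'I_(m + p)) : exists (b : bool) i',
  forall x, pad p (sperm e s x) i 0 = (-1) ^+ b * pad p x i' 0.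
Proof.
case: (split_ordP i) => l ->.
  by exists (e l), (lshift p (s l)) => x; rewrite /pad !col_mxEu mxE.
by exists false, (rshift m l) => x; rewrite /pad !col_mxEd mxE mulr0.
Qed.

(** By [sperm_pad] the coincidence means that a signed permutation fixes [x]; it then fixes [g x],
    and the same formula is read backwards. With a padding index, zeros of [x] become zeros of
    [g x]. *)
Lemma absolutely_symmetric_pad (D : set 'cV[R]_m) g p x (b : bool) (i j : 'I_(m + p)) :
  absolutely_symmetric D g -> D x ->
  pad p x i 0 = (-1) ^+ b * pad p x j 0 ->
  pad p (g x) i 0 = (-1) ^+ b * pad p (g x) j 0.
Proof.
move=> gD Dx xij; have [e [s [c [c0 cE]]]] := sperm_pad b i j.
have /psumr_eq0P x0 : \sum_l (sperm e s x l 0 - x l 0) ^+ 2 = 0.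
  by rewrite cE xij subrr expr0n mulr0.
have xE : sperm e s x = x.
  apply/matrixP => l o; rewrite ord1; apply/eqP; rewrite -subr_eq0 -sqrf_eq0.
  by rewrite x0 // => *; apply: sqr_ge0.
have := cE (g x); rewrite -(absolutely_symmetric_sperm e s gD Dx) xE.
rewrite big1 => [|l _]; last by rewrite subrr expr0n.
by move/esym/eqP; rewrite mulf_eq0 gt_eqF //= sqrf_eq0 subr_eq0 => /eqP.
Qed.

Lemma sort_abs x : exists e s,
  (forall i j : 'I_m, (i <= j)%N -> sperm e s x j 0 <= sperm e s x i 0) /\
  (forall i, 0 <= sperm e s x i 0).
Proof.
pose t := [tuple `|x i 0| | i < m]; pose r := sort >=%O t.
have /tuple_permP[s rE] : perm_eq r t by rewrite perm_sort.
exists (fun i => x (s i) 0 < 0), s.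
have sE i : sperm (fun i => x (s i) 0 < 0) s x i 0 = nth 0 r i.
  have -> : nth 0 r i = `|x (s i) 0|.
    by rewrite rE -tnth_nth !tnth_mktuple.
  rewrite mxE; have [x0|x0] := ltrP (x (s i) 0) 0.
    by rewrite expr1 mulN1r ltr0_norm.
  by rewrite expr0 mul1r ger0_norm.
have sz : size r = m by rewrite size_sort size_tuple.
split=> [i j ij|i]; last first.
  by rewrite sE rE -tnth_nth !tnth_mktuple.
rewrite !sE; apply: (sorted_leq_nth (leT := >=%O)) => //; rewrite ?inE ?sz //.
- by move=> a b c ba ac; exact: le_trans ac ba.
- by move=> a; exact: lexx.
- by apply: sort_sorted => a b; exact: le_total.
Qed.

End SignedPermutations.

(** * Singular values through the characteristic polynomial *)

Section SingularValues.
Variables (R : realType) (k : ground).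
Local Notation K := (ground_field R k).

(** The linear factors determine the multiset of squares; nonnegativity recovers the entries and
    sortedness their order. *)
Lemma is_singular_values_uniq m n (X : 'M[K]_(m, n)) s r :
  is_singular_values X s -> is_singular_values X r -> s = r.
Proof.
case=> ss s0 sE [rs r0 rE].
have := rE; rewrite sE => E.
pose l (v : 'cV[R]_m) := [seq v i 0 | i <- enum 'I_m].
have lE (v : 'cV[R]_m) : \prod_(i < m) ('X - (ofreal k (v i 0 ^+ 2))%:P)
    = \prod_(z <- [seq ofreal k (a ^+ 2) | a <- l v]) ('X - z%:P).
  by rewrite /l -map_comp big_map big_enum.
have lK (v : 'cV[R]_m) : (forall i, 0 <= v i 0) ->
    [seq Num.sqrt (sRe z) | z <- [seq ofreal k (a ^+ 2) | a <- l v]] = l v.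
  move=> v0; rewrite -map_comp map_id_in // => _ /mapP[i _ ->] /=.
  by rewrite ofrealK sqrtr_sqr ger0_norm.
have lS (v : 'cV[R]_m) : (forall i j : 'I_m, (i <= j)%N -> v j 0 <= v i 0) ->
    sorted >=%O (l v).
  move=> vs; rewrite sorted_map.
  have := iota_sorted 0 m; rewrite -val_enum_ord sorted_map.
  by apply: sub_sorted; exact: vs.
have /prod_XsubC_eq/(perm_map (fun z => Num.sqrt (sRe z))) :
    \prod_(z <- [seq ofreal k (a ^+ 2) | a <- l s]) ('X - z%:P)
    = \prod_(z <- [seq ofreal k (a ^+ 2) | a <- l r]) ('X - z%:P).
  by rewrite -!lE.
rewrite !lK // => /(sorted_eq _ _ (lS _ ss) (lS _ rs)) lsr.
have {}lsr : l s = l r.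
  apply: lsr => [a b c ba ac|a b]; first exact: le_trans ac ba.
  by move=> h; apply/le_anti; rewrite andbC.
apply/matrixP => i j; rewrite ord1.
by move/eq_in_map: lsr => /(_ i); apply; rewrite mem_enum.
Qed.

Lemma char_poly_svd m n (U : 'M[K]_m) (V : 'M[K]_n) (y : 'cV[R]_m) :
  (m <= n)%N -> unitary U -> unitary V ->
  let X := U *m diag0 k n y *m adjoint V in
  char_poly (X *m adjoint X) = \prod_(i < m) ('X - (ofreal k (y i 0 ^+ 2))%:P).
Proof.
move=> hmn hU hV X.
pose M : 'M[K]_m := diag_mx (\row_i ofreal k (y i 0 ^+ 2)).
have -> : X *m adjoint X = U *m M *m adjoint U.
  rewrite /X !adjointM adjointK !mulmxA -(mulmxA _ (adjoint V)) hV mulmx1.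
  rewrite -(mulmxA U); congr (_ *m _ *m _); apply/matrixP => i j; rewrite !mxE.
  rewrite (bigD1 (widen_ord hmn i)) //= big1 => [|l li]; last first.
    rewrite mxE; case: ifP => [/eqP il|_]; last by rewrite mul0r.
    by case/eqP: li; exact: val_inj.
  rewrite !mxE eqxx addr0; have [<-|ij] := eqVneq i j.
    by rewrite eqxx sconj_ofreal -rmorphM -expr2 mulr1n.
  by rewrite ifN ?rmorph0 ?mulr0 // eq_sym.
have -> : char_poly (U *m M *m adjoint U) = char_poly M.
  have polyU : map_mx (@polyC K) U *m map_mx (@polyC K) (adjoint U) = 1%:M.
    by rewrite -map_mxM unitaryC // map_mx1.
  have -> : char_poly (U *m M *m adjoint U)
      = \det (map_mx (@polyC K) U *m char_poly_mx M *m map_mx (@polyC K) (adjoint U)).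
    congr (\det _); rewrite /char_poly_mx mulmxBr mulmxBl -!map_mxM.
    by rewrite scalar_mxC -(mulmxA 'X%:M) polyU mulmx1.
  by rewrite !det_mulmx mulrAC -det_mulmx polyU det1 mul1r.
rewrite char_poly_trig; last exact/diag_mx_is_trig.
by apply: eq_bigr => i _; rewrite !mxE eqxx.
Qed.

(** Here [y] may be unsorted and have negative entries. Sorting its absolute values meets the
    characterization, so [xget] returns a genuine value, and uniqueness identifies it. *)
Lemma sigma_svd m n (U : 'M[K]_m) (V : 'M[K]_n) (y : 'cV[R]_m) :
  (m <= n)%N -> unitary U -> unitary V ->
  let s := sigma (U *m diag0 k n y *m adjoint V) in
  [/\ exists e p, s = sperm e p y,
      forall i j : 'I_m, (i <= j)%N -> s j 0 <= s i 0 &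
      forall i, 0 <= s i 0].
Proof.
move=> hmn hU hV; set X := _ *m _ => s.
have [e [p [ys y0]]] := sort_abs y.
have hX : is_singular_values X (sperm e p y).
  split=> //; rewrite char_poly_svd // (reindex_inj (@perm_inj _ p)) /=.
  by apply: eq_bigr => i _; rewrite mxE exprMn sqrr_sign mul1r.
have hs : is_singular_values X s.
  exact: (@xgetI _ 0 [set v | is_singular_values X v] _ hX).
have sE := is_singular_values_uniq hs hX.
by split; rewrite sE //; exists e, p.
Qed.

End SingularValues.

(** * Frobenius balls as a neighbourhood base *)

Section FrobeniusTopology.
Variables (R : realType) (k : ground) (m n : nat).
Local Notation K := (ground_field R k).

Lemma nbhs_frobP (X : 'M[K]_(m, n)) (W : set 'M[K]_(m, n)) :
  nbhs X W <-> exists2 e : R, 0 < e & forall Y, frob_norm (Y - X) < e -> W Y.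
Proof.
split=> [/nbhs_ballP[e0 /= e0_gt0 We]|[e e0 We]].
  have [e e_gt0 e0E] := gt0_ofreal e0_gt0; exists e => // Y YX; apply: We.
  split=> // i j; rewrite -ball_normE /= distrC e0E normr_ofreal ofreal_lt.
  apply: le_lt_trans YX; rewrite -(ger0_norm (frob_norm_ge0 (Y - X))) -sqrtr_sqr.
  by have := entry_le_frob_norm (Y - X) i j; rewrite !mxE; apply: ler_wsqrtr.
(* Entries of modulus below [d] give squared norm at most [m n d^2]; the added 1 makes this smaller
   than [e^2] and the denominator positive. *)
pose d := e / ((m * n)%:R + 1).
have d0 : 0 < d by rewrite divr_gt0 // ltr_wpDl.
apply/nbhs_ballP; exists (ofreal k d) => [|Y [_ XY]] /=.
  by rewrite -(rmorph0 (ofreal k)) ofreal_lt.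
apply: We; rewrite -ltr_sqr ?nnegrE ?frob_norm_ge0 ?(ltW e0) //.
apply: (@le_lt_trans _ _ ((m * n)%:R * d ^+ 2)).
  have -> : (m * n)%:R * d ^+ 2 = \sum_(i < m) \sum_(j < n) d ^+ 2.
    by rewrite !sumr_const !card_ord -mulrnA mulr_natl mulnC.
  rewrite frob_normE; apply: ler_sum => i _; apply: ler_sum => j _.
  have := XY i j; rewrite -ball_normE /= distrC normr_ofreal ofreal_lt => h.
  rewrite -[leLHS]sqr_sqrtr ?sqnorm_ge0 // !mxE.
  by rewrite ler_sqr ?nnegrE ?sqrtr_ge0 ?ltW.
have -> : e = d * ((m * n)%:R + 1) by rewrite divfK // gt_eqF // ltr_wpDl.
by have : 0 <= (m * n)%:R :> R by []; move: (_%:R) d0 => N; nra.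
Qed.

(* Squared norms keep every later estimate polynomial. *)
Lemma locally_lipschitz_nearP (D : set 'M[K]_(m, n)) F (X : 'M[K]_(m, n)) :
  locally_lipschitz_near D F X <-> exists e L : R,
    [/\ 0 < e, 0 <= L, forall Y, frob_norm (Y - X) ^+ 2 < e ^+ 2 -> D Y &
      forall Y Z, frob_norm (Y - X) ^+ 2 < e ^+ 2 ->
        frob_norm (Z - X) ^+ 2 < e ^+ 2 ->
        frob_norm (F Y - F Z) ^+ 2 <= L * frob_norm (Y - Z) ^+ 2].
Proof.
have sqE (e : R) (Y : 'M[K]_(m, n)) : 0 < e ->
    (frob_norm Y ^+ 2 < e ^+ 2) = (frob_norm Y < e).
  by move=> e0; rewrite ltr_sqr ?nnegrE ?frob_norm_ge0 ?ltW.
split=> [[W [Wo WX WD [L WL]]]|[e [L [e0 L0 eD eL]]]].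
  have /nbhs_frobP[e e0 We] : nbhs X W by exact: open_nbhs_nbhs.
  (* The given [L] has no prescribed sign, but its product with a distance bounds a norm, so
     squaring is legitimate. *)
  exists e, (L ^+ 2); split=> // [|Y|Y Z]; rewrite ?sqr_ge0 ?sqE //.
    by move=> /We/WD.
  move=> /We WY /We WZ; rewrite -exprMn; have := WL _ _ WY WZ => h.
  by rewrite ler_sqr ?nnegrE ?frob_norm_ge0 //; apply: le_trans h; apply: frob_norm_ge0.
exists (interior [set Y | frob_norm (Y - X) < e]); split.
- exact: open_interior.
- by apply/nbhs_frobP; exists e.
- by move=> Y /interior_subset /= Ye; apply: eD; rewrite sqE.
exists (Num.sqrt L) => Y Z /interior_subset /= Ye /interior_subset /= Ze.
rewrite -ler_sqr ?nnegrE ?mulr_ge0 ?sqrtr_ge0 ?frob_norm_ge0 //.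
by rewrite exprMn (sqr_sqrtr L0); apply: eL; rewrite sqE.
Qed.

End FrobeniusTopology.

(** * Bounds for [g], singular values and spectral values through the weights *)

Section LipschitzTransfer.
Variables (R : realType) (k : ground).
Local Notation K := (ground_field R k).

Lemma sperm_lipschitz m (D : set 'cV[R]_m) g (c : 'cV[R]_m) (e L : R) :
  0 < e -> 0 <= L -> absolutely_symmetric D g ->
  (forall y : 'cV[R]_m, \sum_i (y i 0 - c i 0) ^+ 2 < e ^+ 2 -> D y) ->
  (forall y z : 'cV[R]_m, \sum_i (y i 0 - c i 0) ^+ 2 < e ^+ 2 ->
    \sum_i (z i 0 - c i 0) ^+ 2 < e ^+ 2 ->
    \sum_i (g y i 0 - g z i 0) ^+ 2 <= L * \sum_i (y i 0 - z i 0) ^+ 2) ->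
  exists2 M : R, 0 <= M & forall (x : 'cV[R]_m) q s,
    \sum_i (x i 0 - c i 0) ^+ 2 < (e / 2) ^+ 2 ->
    \sum_i (sperm q s (g x) i 0 - g x i 0) ^+ 2
      <= M * \sum_i (sperm q s x i 0 - x i 0) ^+ 2.
Proof.
move=> e0 L0 gD eD eL.
(* Bound for the squared norm of [g] on the ball of radius [e] around [c]. *)
pose C := 2 * (\sum_i g c i 0 ^+ 2) + 2 * (L * e ^+ 2).
have C0 : 0 <= C.
  apply: addr_ge0; apply: mulr_ge0 => //; last by rewrite mulr_ge0 ?sqr_ge0.
  by apply: sumr_ge0 => i _; apply: sqr_ge0.
have e20 : 0 < e ^+ 2 by rewrite exprn_gt0.
(* [L] serves small displacements. For a squared displacement [d] of at least [(e / 2) ^+ 2], the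
   bound [4 * C] is at most [16 * C / e ^+ 2 * d]. *)
exists (L + 16 * C / e ^+ 2) => [|x q s xc].
  by rewrite addr_ge0 // divr_ge0 ?mulr_ge0 // ltW.
have cc : \sum_i (c i 0 - c i 0) ^+ 2 < e ^+ 2.
  by rewrite big1 // => i _; rewrite subrr expr0n.
have xe : \sum_i (x i 0 - c i 0) ^+ 2 < e ^+ 2.
  apply: lt_le_trans xc _; rewrite expr_div_n; lra.
set d := \sum_i (sperm q s x i 0 - x i 0) ^+ 2.
have d0 : 0 <= d by apply: sumr_ge0 => *; apply: sqr_ge0.
have C'0 : 0 <= 16 * C / e ^+ 2 by rewrite divr_ge0 ?mulr_ge0 // ltW.
have [near|far] := ltP d ((e / 2) ^+ 2).
  (* The halved radius pays off here: two steps of length below [e / 2] stay in the ball. *)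
  have qe : \sum_i (sperm q s x i 0 - c i 0) ^+ 2 < e ^+ 2.
    apply: (@le_lt_trans _ _ (2 * d + 2 * \sum_i (x i 0 - c i 0) ^+ 2)).
      rewrite !mulr_sumr -big_split; apply: ler_sum => i _ /=.
      move: (sperm _ _ _ _ _) (x i 0) (c i 0) => u v w.
      by have := sqr_ge0 (u - 2 * v + w); nra.
    move: near xc; rewrite expr_div_n; lra.
  have := eL _ _ qe xe; rewrite -/d (absolutely_symmetric_sperm _ _ gD); last exact: eD.
  by move/le_trans; apply; rewrite ler_wpM2r // lerDl.
have gx : \sum_i g x i 0 ^+ 2 <= C.
  apply: (@le_trans _ _
    (2 * (\sum_i g c i 0 ^+ 2) + 2 * \sum_i (g x i 0 - g c i 0) ^+ 2)).
    rewrite !mulr_sumr -big_split; apply: ler_sum => i _ /=.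
    move: (g x i 0) (g c i 0) => u v.
    by have := sqr_ge0 (u - 2 * v); nra.
  rewrite lerD2l ler_wpM2l //; apply: le_trans (eL _ _ xe cc) _.
  by rewrite ler_wpM2l // ltW.
apply: le_trans (sum_sperm_le _ _ _) _.
apply: (@le_trans _ _ (16 * C / e ^+ 2 * d)); last by rewrite ler_wpM2r // lerDr.
apply: (@le_trans _ _ (16 * C / e ^+ 2 * (e / 2) ^+ 2)); last by rewrite ler_wpM2l.
have -> : 16 * C / e ^+ 2 * (e / 2) ^+ 2 = 4 * C by field; rewrite gt_eqF.
by rewrite ler_wpM2l.
Qed.

Lemma sum_pad m p (a b : 'cV[R]_m) :
  \sum_i (pad p a i 0 - pad p b i 0) ^+ 2 = \sum_i (a i 0 - b i 0) ^+ 2.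
Proof.
rewrite big_split_ord /= [X in _ + X]big1 ?addr0 => [|i _].
  by apply: eq_bigr => i _; rewrite /pad !col_mxEu.
by rewrite /pad !col_mxEd mxE subrr expr0n.
Qed.

Lemma pad_nonincreasing m p (x : 'cV[R]_m) :
  (forall i j : 'I_m, (i <= j)%N -> x j 0 <= x i 0) -> (forall i, 0 <= x i 0) ->
  forall i j : 'I_(m + p), (i <= j)%N -> pad p x j 0 <= pad p x i 0.
Proof.
move=> xs x0 i j; rewrite /pad.
case: (split_ordP i) => i' ->; case: (split_ordP j) => j' -> /=;
  rewrite ?col_mxEu ?col_mxEd ?mxE //; first exact: xs.
by rewrite leqNgt (leq_trans (ltn_ord j')) // leq_addr.
Qed.

Lemma pad_ge0 m p (x : 'cV[R]_m) :
  (forall i, 0 <= x i 0) -> forall i, 0 <= pad p x i 0.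
Proof.
by move=> x0 i; rewrite /pad; case: (split_ordP i) => l ->;
  rewrite ?col_mxEu ?col_mxEd ?mxE.
Qed.

(** Each coordinate is bounded separately, whence the factor [n]. Nonnegativity gives
    [(x j - y i)^2 <= (x j + y i)^2], so [wm + wp] can act as a single weight on differences. *)
Lemma pair_dist_weyl n (wm wp : 'I_n -> 'I_n -> R) (x y : 'cV[R]_n) :
  (forall i j, 0 <= wp i j) -> doubly_stochastic (fun i j => wm i j + wp i j) ->
  (forall i j : 'I_n, (i <= j)%N -> x j 0 <= x i 0) -> (forall i, 0 <= x i 0) ->
  (forall i j : 'I_n, (i <= j)%N -> y j 0 <= y i 0) -> (forall i, 0 <= y i 0) ->
  \sum_i (y i 0 - x i 0) ^+ 2 <= n%:R * pair_dist wm wp x y.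
Proof.
move=> wp0 ww xs x0 ys y0.
have -> : n%:R * pair_dist wm wp x y = \sum_(c < n) pair_dist wm wp x y.
  by rewrite sumr_const card_ord mulr_natl.
apply: ler_sum => c _.
apply: le_trans (@doubly_stochastic_weyl _ _ _ (fun i => y i 0) (fun i => x i 0) c
  ww ys xs) _.
apply: ler_sum => i _; apply: ler_sum => j _; rewrite mulrDl lerD2l.
apply: ler_wpM2l => //.
by have := x0 j; have := y0 i; nra.
Qed.

Lemma svd_sigma_dist m p (X Y : 'M[K]_(m, m + p)) (U1 U2 : 'M[K]_m)
    (V1 V2 : 'M[K]_(m + p)) (x y : 'cV[R]_m) :
  unitary U1 -> unitary U2 -> unitary V1 -> unitary V2 ->
  X = U1 *m diag0 k (m + p) x *m adjoint V1 ->
  Y = U2 *m diag0 k (m + p) y *m adjoint V2 ->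
  (forall i j : 'I_m, (i <= j)%N -> x j 0 <= x i 0) -> (forall i, 0 <= x i 0) ->
  (forall i j : 'I_m, (i <= j)%N -> y j 0 <= y i 0) -> (forall i, 0 <= y i 0) ->
  \sum_i (x i 0 - y i 0) ^+ 2 <= (m + p)%:R * frob_norm (X - Y) ^+ 2.
Proof.
move=> hU1 hU2 hV1 hV2 -> -> xs x0 ys y0.
have [wm [wp [_ wp0 ww wE]]] := svd_dist hU1 hU2 hV1 hV2.
rewrite wE; under eq_bigr do rewrite -sqrrN opprB; rewrite -(sum_pad p).
by apply: pair_dist_weyl => //; do ?[exact: pad_nonincreasing|exact: pad_ge0].
Qed.

(* Termwise: [g_j(x) -+ g_i(y)] is compared with [g_j(x) -+ g_i(x)], which the
   signed permutations control, and [g_i(x) - g_i(y)]. *)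
Lemma pair_dist_lipschitz n (wm wp : 'I_n -> 'I_n -> R) (x y u v : 'cV[R]_n) (M : R) :
  0 <= M ->
  (forall i j, 0 <= wm i j) -> (forall i j, 0 <= wp i j) ->
  doubly_stochastic (fun i j => wm i j + wp i j) ->
  (forall (b : bool) i j, ((-1) ^+ b * u j 0 - u i 0) ^+ 2
     <= M * ((-1) ^+ b * x j 0 - x i 0) ^+ 2) ->
  pair_dist wm wp u v <= 4 * M * pair_dist wm wp x y
    + 4 * M * (\sum_i (x i 0 - y i 0) ^+ 2) + 2 * \sum_i (u i 0 - v i 0) ^+ 2.
Proof.
move=> M0 wm0 wp0 [_ wr _] uM.
rewrite -addrA /pair_dist !mulr_sumr -!big_split; apply: ler_sum => i _ /=.
(* [r] collects the terms depending on [i] alone; unit row sums spread it over [j]. *)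
set r := (X in _ + X).
have -> : r = \sum_j (wm i j + wp i j) * r by rewrite -mulr_suml wr mul1r.
rewrite mulr_sumr -big_split; apply: ler_sum => j _ /=.
have M4 : 0 <= 4 * M by rewrite mulr_ge0.
have minus : (u j 0 - v i 0) ^+ 2 <= 4 * M * (x j 0 - y i 0) ^+ 2 + r.
  have := uM false i j; rewrite expr0 !mul1r => h.
  have h1 : (u j 0 - v i 0) ^+ 2
      <= 2 * (u j 0 - u i 0) ^+ 2 + 2 * (u i 0 - v i 0) ^+ 2.
    by have := sqr_ge0 (u j 0 - 2 * u i 0 + v i 0); nra.
  have h2 : M * (x j 0 - x i 0) ^+ 2
      <= M * (2 * (x j 0 - y i 0) ^+ 2 + 2 * (x i 0 - y i 0) ^+ 2).
    by apply: ler_wpM2l => //; have := sqr_ge0 (x j 0 - 2 * y i 0 + x i 0); nra.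
  by rewrite /r; lra.
have plus : (u j 0 + v i 0) ^+ 2 <= 4 * M * (x j 0 + y i 0) ^+ 2 + r.
  have := uM true i j; rewrite expr1 !mulN1r => h.
  have h1 : (u j 0 + v i 0) ^+ 2
      <= 2 * (- u j 0 - u i 0) ^+ 2 + 2 * (u i 0 - v i 0) ^+ 2.
    by have := sqr_ge0 (u j 0 + 2 * u i 0 - v i 0); nra.
  have h2 : M * (- x j 0 - x i 0) ^+ 2
      <= M * (2 * (x j 0 + y i 0) ^+ 2 + 2 * (x i 0 - y i 0) ^+ 2).
    by apply: ler_wpM2l => //; have := sqr_ge0 (x j 0 + 2 * y i 0 - x i 0); nra.
  by rewrite /r; lra.
have := ler_wpM2l (wm0 i j) minus; have := ler_wpM2l (wp0 i j) plus; lra.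
Qed.

End LipschitzTransfer.

(** [G] is specified through one decomposition with sorted singular values, whereas [y] may be
    unsorted or signed. The two decompositions of the same matrix are at distance zero, and absolute
    symmetry passes this on to their images under [g]. *)
Lemma spectral_operator_svd (R : realType) (k : ground) (m p : nat)
  (N : set 'M[ground_field R k]_(m, m + p)) (sN : set 'cV[R]_m)
  (g : 'cV[R]_m -> 'cV[R]_m)
  (G : 'M[ground_field R k]_(m, m + p) -> 'M[ground_field R k]_(m, m + p))
  (U : 'M[ground_field R k]_m) (V : 'M[ground_field R k]_(m + p)) (y : 'cV[R]_m) :
  absolutely_symmetric sN g -> is_spectral_operator N g G ->
  unitary U -> unitary V -> sN y ->
  N (U *m diag0 k (m + p) y *m adjoint V) ->
  G (U *m diag0 k (m + p) y *m adjoint V)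
  = U *m diag0 k (m + p) (g y) *m adjoint V.
Proof.
move=> gD GN hU hV sNy NX; set X := U *m _ *m _ in NX *.
have [[U' V'] /= [/= hU' hV' XE] GE] := GN X NX.
have [[e [s sE]] _ _] := sigma_svd y (leq_addr p m) hU hV.
have [wm [wp [wm0 wp0 _ wE]]] := svd_dist hU hU' hV hV'.
apply/eqP; rewrite eq_sym -subr_eq0; apply/eqP/frob_norm_eq0.
rewrite GE wE.
(* A vanishing sum of nonnegative terms: a weight can be nonzero only where the two entries agree up
   to its sign. *)
have t0 i j : wm i j * (pad p y j 0 - pad p (sigma X) i 0) ^+ 2 = 0 /\
              wp i j * (pad p y j 0 + pad p (sigma X) i 0) ^+ 2 = 0.
  have : pair_dist wm wp (pad p y) (pad p (sigma X)) = 0.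
    by rewrite -wE -XE subrr frob_normE big1 // => ? _; rewrite big1 // => ? _;
      rewrite mxE sqnorm0.
  have c0 i' j' : 0 <= wm i' j' * (pad p y j' 0 - pad p (sigma X) i' 0) ^+ 2 /\
              0 <= wp i' j' * (pad p y j' 0 + pad p (sigma X) i' 0) ^+ 2.
    by split; rewrite mulr_ge0 ?sqr_ge0.
  have d0 i' j' : 0 <= wm i' j' * (pad p y j' 0 - pad p (sigma X) i' 0) ^+ 2 +
              wp i' j' * (pad p y j' 0 + pad p (sigma X) i' 0) ^+ 2.
    by have [? ?] := c0 i' j'; rewrite addr_ge0.
  move/psumr_eq0P => /(_ (fun i _ => sumr_ge0 _ (fun j _ => d0 i j)) i isT).
  move/psumr_eq0P => /(_ (fun j _ => d0 i j) j isT)/eqP.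
  by have [? ?] := c0 i j; rewrite paddr_eq0 // => /andP[/eqP ? /eqP ?].
(* As [sigma X] is a signed permutation of [y], this compares two entries of [y] itself. *)
have key (b : bool) i j : pad p y j 0 = (-1) ^+ b * pad p (sigma X) i 0 ->
    pad p (g y) j 0 = (-1) ^+ b * pad p (g (sigma X)) i 0.
  have gsE : g (sigma X) = sperm e s (g y).
    by rewrite sE; apply: absolutely_symmetric_sperm gD sNy.
  rewrite gsE sE; have [b' [i' pE]] := pad_sperm R e s i.
  rewrite !pE !mulrA -signr_addb; exact: absolutely_symmetric_pad gD sNy.
rewrite /pair_dist big1 // => i _; rewrite big1 // => j _.
have [/eqP tm /eqP tp] := t0 i j.
rewrite [X in X + _](_ : _ = 0) ?add0r; last first.
  move: tm; rewrite mulf_eq0 => /orP[/eqP->|]; first by rewrite mul0r.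
  rewrite sqrf_eq0 subr_eq0 => /eqP h.
  by rewrite (key false i j) ?expr0 ?mul1r // subrr expr0n mulr0.
move: tp; rewrite mulf_eq0 => /orP[/eqP->|]; first by rewrite mul0r.
rewrite sqrf_eq0 addr_eq0 => /eqP h.
by rewrite (key true i j) ?expr1 ?mulN1r // addNr expr0n mulr0.
Qed.

(** * Both implications between the Lipschitz continuity of [g] and of [G] *)

Theorem theorem3p3 (R : realType) (k : ground) (m n : nat) (hmn : (m <= n)%N)
  (N : set 'M[ground_field R k]_(m, n)) (N_neq0 : N !=set0) (N_open : open N)
  (sN : set 'cV[R]_m) (sN_open : open sN)
  (sigmaN : [set sigma X | X in N] `<=` sN)
  (g : 'cV[R]_m -> 'cV[R]_m) (g_sym : absolutely_symmetric sN g)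
  (G : 'M[ground_field R k]_(m, n) -> 'M[ground_field R k]_(m, n))
  (G_spec : is_spectral_operator N g G)
  (Xbar : 'M[ground_field R k]_(m, n)) (N_Xbar : N Xbar)
  (Ubar : 'M[ground_field R k]_m) (Vbar : 'M[ground_field R k]_n)
  (UVbar : svd_pairs Xbar (Ubar, Vbar)) :
  locally_lipschitz_near N G Xbar <->
  @locally_lipschitz_near R ground_real m 1 setT g (sigma Xbar).
Proof.
have [q nE] : exists q, n = (m + q)%N by exists (n - m)%N; rewrite subnKC.
subst n; move: UVbar => [/= hU hV XE].
set c := sigma Xbar in XE *.
have sNc : sN c by apply: sigmaN; exists Xbar.
have [e1 e1_gt0 e1E] : exists2 e : R, 0 < e &
    forall y : 'cV[R]_m, \sum_i (y i 0 - c i 0) ^+ 2 < e ^+ 2 -> sN y.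
  have : nbhs c sN by exact: open_nbhs_nbhs.
  move/(@nbhs_frobP R ground_real m 1) => [e e0 eE]; exists e => // y yc; apply: eE.
  rewrite -ltr_sqr ?nnegrE ?frob_norm_ge0 ?ltW // frob_norm_col.
  by under eq_bigr do rewrite !mxE.
have colE (x y : 'cV[R]_m) :
    @frob_norm R ground_real m 1 (x - y) ^+ 2 = \sum_i (x i 0 - y i 0) ^+ 2.
  by rewrite frob_norm_col; under eq_bigr do rewrite !mxE.
have min_sqr (a b z : R) : 0 < a -> 0 < b -> z < Num.min a b ^+ 2 ->
    z < a ^+ 2 /\ z < b ^+ 2.
  move=> a0 b0 /lt_le_trans h.
  have mn0 : 0 < Num.min a b by rewrite lt_min a0.
  by split; apply: h;
    rewrite ler_sqr ?nnegrE ?(ltW mn0) ?(ltW a0) ?(ltW b0) // ge_min lexx ?orbT.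
pose D (y : 'cV[R]_m) := Ubar *m diag0 k (m + q) y *m adjoint Vbar.
have DE y z : frob_norm (D y - D z) ^+ 2 = \sum_i (y i 0 - z i 0) ^+ 2.
  rewrite /D -mulmxBl -mulmxBr -diag0B frob_norm_unitary // frob_norm_diag0 //.
  by under eq_bigr do rewrite !mxE.
split=> /locally_lipschitz_nearP [e [L [e0 L0 eD eL]]];
  apply/locally_lipschitz_nearP.
  exists (Num.min e e1), L; split=> // [|y z].
    by rewrite lt_min e0.
  rewrite !colE => /min_sqr [] // ye ye1 /min_sqr [] // ze ze1.
  have near_D (x : 'cV[R]_m) : \sum_i (x i 0 - c i 0) ^+ 2 < e ^+ 2 ->
      frob_norm (D x - Xbar) ^+ 2 < e ^+ 2 by rewrite {1}XE DE.
  (* Both radii matter: [e] keeps [D x] in [N], and [e1] keeps [x] in the set where [g] is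
     absolutely symmetric. *)
  have GE (x : 'cV[R]_m) : \sum_i (x i 0 - c i 0) ^+ 2 < e ^+ 2 ->
      \sum_i (x i 0 - c i 0) ^+ 2 < e1 ^+ 2 -> G (D x) = D (g x).
    move=> xe xe1; apply: (spectral_operator_svd g_sym G_spec) => //.
      exact: e1E.
    by apply: eD; exact: near_D.
  have := eL _ _ (near_D _ ye) (near_D _ ze).
  by rewrite !GE // !DE.
(* Source of the final constant: [F], [S] and [T] stand for the squared distances of the matrices,
   of their singular values and of the values of [g]. *)
have combine (M d S T F : R) : 4 * M * S <= 4 * M * (d * F) ->
    L * S <= L * (d * F) -> T <= L * S ->
    4 * M * F + 4 * M * S + 2 * T <= (4 * M + (4 * M + 2 * L) * d) * F.
  by move=> *; lra.
pose e2 := Num.min e e1.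
have e2_gt0 : 0 < e2 by rewrite lt_min e0.
have gL (y z : 'cV[R]_m) : \sum_i (y i 0 - c i 0) ^+ 2 < e2 ^+ 2 ->
    \sum_i (z i 0 - c i 0) ^+ 2 < e2 ^+ 2 ->
    \sum_i (g y i 0 - g z i 0) ^+ 2 <= L * \sum_i (y i 0 - z i 0) ^+ 2.
  move=> /min_sqr [] // ye _ /min_sqr [] // ze _.
  by rewrite -!colE; apply: eL; rewrite colE.
have [M M0 MP] : exists2 M : R, 0 <= M & forall (x : 'cV[R]_m) r s,
    \sum_i (x i 0 - c i 0) ^+ 2 < (e2 / 2) ^+ 2 ->
    \sum_i (sperm r s (g x) i 0 - g x i 0) ^+ 2
      <= M * \sum_i (sperm r s x i 0 - x i 0) ^+ 2.
  apply: (sperm_lipschitz e2_gt0 L0 g_sym) => // y /min_sqr [] // _.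
  exact: e1E.
have [e3 e3_gt0 NE] : exists2 e : R, 0 < e &
    forall Y, frob_norm (Y - Xbar) ^+ 2 < e ^+ 2 -> N Y.
  have : nbhs Xbar N by exact: open_nbhs_nbhs.
  move/nbhs_frobP => [e' e'0 eE]; exists e' => // Y YX; apply: eE.
  by rewrite -ltr_sqr ?nnegrE ?frob_norm_ge0 ?ltW.
pose d : R := (m + q)%:R.
have d0 : 0 <= d by [].
(* Since [d < (d + 1)^2], matrices within [e4] of [Xbar] have singular values within [e2 / 2] of
   [c], as [MP] requires. *)
pose e4 := e2 / 2 / (d + 1).
have e4_gt0 : 0 < e4 by rewrite !divr_gt0 // ltr_wpDl.
exists (Num.min e3 e4), (4 * M + (4 * M + 2 * L) * d).
have svdN X : N X -> exists (U : 'M[ground_field R k]_m)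
      (V : 'M[ground_field R k]_(m + q)), [/\ unitary U, unitary V,
      X = U *m diag0 k (m + q) (sigma X) *m adjoint V,
      G X = U *m diag0 k (m + q) (g (sigma X)) *m adjoint V &
      (forall i j : 'I_m, (i <= j)%N -> sigma X j 0 <= sigma X i 0) /\
      (forall i, 0 <= sigma X i 0)].
  move=> NX; have [[U V] /= [/= hU' hV' XE'] GE] := G_spec X NX.
  exists U, V; split=> //.
  have := sigma_svd (sigma X) (leq_addr q m) hU' hV'.
  by rewrite -XE' => -[].
have sigma_lip X Y : N X -> N Y ->
    \sum_i (sigma X i 0 - sigma Y i 0) ^+ 2 <= d * frob_norm (X - Y) ^+ 2.
  move=> /svdN [U1 [V1 [hU1 hV1 XE1 _ [xs x0]]]].
  move=> /svdN [U2 [V2 [hU2 hV2 YE2 _ [ys y0]]]].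
  exact: (svd_sigma_dist hU1 hU2 hV1 hV2 XE1 YE2 xs x0 ys y0).
split=> [|||X Y].
- by rewrite lt_min e3_gt0.
- by rewrite addr_ge0 ?mulr_ge0 ?addr_ge0 ?mulr_ge0.
- by move=> Y /min_sqr [] // /NE.
move=> /min_sqr [] // /NE NX Xe /min_sqr [] // /NE NY Ye.
have near X' : N X' -> frob_norm (X' - Xbar) ^+ 2 < e4 ^+ 2 ->
    \sum_i (sigma X' i 0 - c i 0) ^+ 2 < (e2 / 2) ^+ 2.
  move=> NX' h; apply: le_lt_trans (sigma_lip _ _ NX' N_Xbar) _.
  have -> : e2 / 2 = e4 * (d + 1) by rewrite divfK // gt_eqF // ltr_wpDl.
  apply: (@le_lt_trans _ _ (d * e4 ^+ 2)); first by rewrite ler_wpM2l // ltW.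
  by rewrite [(e4 * _) ^+ 2]exprMn mulrC ltr_pM2l ?exprn_gt0 //; have := sqr_ge0 d; lra.
have half (x : 'cV[R]_m) : \sum_i (x i 0 - c i 0) ^+ 2 < (e2 / 2) ^+ 2 ->
    \sum_i (x i 0 - c i 0) ^+ 2 < e2 ^+ 2.
  by move/lt_le_trans; apply; rewrite expr_div_n; have := sqr_ge0 e2; lra.
have xc := near _ NX Xe; have yc := near _ NY Ye.
have s_lip := sigma_lip _ _ NX NY.
have g_lip := gL _ _ (half _ xc) (half _ yc).
have [U1 [V1 [hU1 hV1 XE1 GX _]]] := svdN _ NX.
have [U2 [V2 [hU2 hV2 YE2 GY _]]] := svdN _ NY.
have [wm [wp [wm0 wp0 ww wE]]] := svd_dist hU1 hU2 hV1 hV2.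
have XYE : frob_norm (X - Y) ^+ 2
    = pair_dist wm wp (pad q (sigma X)) (pad q (sigma Y)).
  exact: etrans (congr2 (fun A B => frob_norm (A - B) ^+ 2) XE1 YE2)
    (wE (sigma X) (sigma Y)).
rewrite GX GY wE.
(* The factor [a] relating displacement to pair difference is the same for [sigma X] and for its
   image under [g], so it cancels. *)
have pairM (b : bool) i j :
    ((-1) ^+ b * pad q (g (sigma X)) j 0 - pad q (g (sigma X)) i 0) ^+ 2
    <= M * ((-1) ^+ b * pad q (sigma X) j 0 - pad q (sigma X) i 0) ^+ 2.
  have [r [s [a [a0 aE]]]] := sperm_pad R b i j.
  by have := MP _ r s xc; rewrite !aE (mulrCA M) ler_pM2l.
apply: le_trans (pair_dist_lipschitz (pad q (sigma Y)) (pad q (g (sigma Y)))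
  M0 wm0 wp0 ww pairM) _.
rewrite !sum_pad -XYE.
have h1 : 4 * M * \sum_i (sigma X i 0 - sigma Y i 0) ^+ 2
    <= 4 * M * (d * frob_norm (X - Y) ^+ 2) by rewrite ler_wpM2l ?mulr_ge0.
have h2 : L * \sum_i (sigma X i 0 - sigma Y i 0) ^+ 2
    <= L * (d * frob_norm (X - Y) ^+ 2) by rewrite ler_wpM2l.
exact: combine h1 h2 g_lip.
Qed.
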